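(* Assume $\tau=\mathrm{SB}_{\mathcal A}(\Omega)>0$, let $K=\tau/(L(1+\tau))$, and let $\{x_k\}$ be an infinite sequence generated by the first-order method with SSC (all calls to the SSC procedure terminating). Then $\{f(x_k)\}$ is decreasing (i.e. $f(x_{k+1})\le f(x_k)$), $f(x_k)\to f^*$ for some $f^*\in\mathbb R$, and the limit points of $\{x_k\}$ are stationary. Furthermore, for any sequence $\{\tilde x_k\}\subset\Omega$ satisfying $\|x_k-x_{k+1}^{tr}\|\ge K\|\pi(T_\Omega(\tilde x_k),-\nabla f(\tilde x_k))\|$ for all $k$, $$\min_{0\le i\le k}\|\pi(T_\Omega(\tilde x_i),-\nabla f(\tilde x_i))\|\ \le\ \min_{0\le i\le k}\frac{\|x_{i+1}^{tr}-x_i\|}{K}\ \le\ \sqrt{\frac{2(f(x_0)-f^* )}{K^2L(k+1)}}$$ for all $k\geq 0$.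
   Context: $\Omega\subset\mathbb R^n$ is nonempty, compact and convex; $f\in C^1(\Omega)$ satisfies $\|\nabla f(x)-\nabla f(y)\|\le L\|x-y\|$ for all $x,y\in\Omega$, with $L>0$. $T_\Omega(x)$ is the tangent cone of $\Omega$ at $x$, $\pi(C,\cdot)$ the Euclidean projection on a closed convex set $C$, $\pi_x(g)=\|\pi(T_\Omega(x),g)\|$, $\hat c=c/\|c\|$ for $c\neq0$ and $\hat 0=0$, and $\bar B_R(x)$ is the closed Euclidean ball. A point $x\in\Omega$ is stationary if $\pi_x(-\nabla f(x))=0$. Method. A method $\mathcal A$ assigns to each $(x,g)\in\Omega\times\mathbb R^n$ a nonempty set of feasible directions $\mathcal A(x,g)\subset (T_\Omega(x)\cap\{y:\langle g,y\rangle>0\})\cup\{0\}$; $\mathcal A(x,g)=\{0\}$ if $\pi_x(g)=0$, and $0\notin\mathcal A(x,g)$ otherwise. Slope bounds. $\mathrm{DSB}_{\mathcal A}(\Omega,x,g)=\inf_{d\in\mathcal A(x,g)}\frac{\langle g,d\rangle}{\pi_x(g)\|d\|}$ if $\pi_x(g)\ne0$ and $\mathrm{DSB}_{\mathcal A}(\Omega,x,g)=1$ otherwise; $\mathrm{SB}_{\mathcal A}(\Omega)=\inf_{x\in\Omega,\,g\in\mathbb R^n}\mathrm{DSB}_{\mathcal A}(\Omega,x,g)$. SSC procedure SSC$(\bar x,g)$. Set $y_0=\bar x$, $j=0$ and iterate. (I) Choose $d_j\in\mathcal A(y_j,g)$ and a maximal stepsize $\alpha_{\max}^{(j)}$; it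 is assumed that if $d_j\neq0$ then $\alpha_{\max}^{(j)}>0$ and $y_j+\alpha d_j\in\Omega$ for all $\alpha\in[0,\alpha_{\max}^{(j)}]$. If $d_j=0$, return $y_j$. (II) Let $\Omega_j=\bar B_{\|g\|/(2L)}(\bar x+\frac{g}{2L})\cap\bar B_{\langle g,\hat d_j\rangle/L}(\bar x)$; set $\beta_j=0$ if $y_j\notin\Omega_j$ and $\beta_j=\max\{\beta\ge0: y_j+\beta d_j\in\Omega_j\}$ if $y_j\in\Omega_j$; let $\alpha_j=\min(\alpha_{\max}^{(j)},\beta_j)$. If $\alpha_j=0$, return $y_j$. (III) Set $y_{j+1}=y_j+\alpha_jd_j$. If $\alpha_j=\beta_j$, return $y_{j+1}$; otherwise increase $j$ by 1 and repeat from (I). First-order method with SSC. Start from $x_0\in\Omega$; while $x_k$ is not stationary, set $g=-\nabla f(x_k)$, compute $x_{k+1}^{tr}=\mathrm{SSC}(x_k,g)$, and select any $x_{k+1}\in\Omega$ with $f(x_{k+1})\le\min\big(f(x_{k+1}^{tr}),\,f(x_k)-\frac L2\|x_{k+1}-x_k\|^2\big)$. *)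

(* Defs.v *)
From HB Require Import structures.
From mathcomp Require Import all_boot all_order all_algebra.
From mathcomp Require Import all_classical all_reals all_analysis.

Set Implicit Arguments.
Unset Strict Implicit.
Unset Printing Implicit Defensive.

Import Order.TTheory GRing.Theory Num.Theory.
Import numFieldNormedType.Exports.

Local Open Scope classical_set_scope.
Local Open Scope ring_scope.

Section euclidean.
Context {R : realType} {n : nat}.
Local Notation E := 'rV[R]_n.

(* The library norm `|_| on 'rV[R]_n is the sup norm; all distances below are
   Euclidean. Only the topology (which is the same) is taken from the library. *)
Definition dot (u v : E) : R := \sum_(i < n) u 0 i * v 0 i.

Definition enorm (u : E) : R := Num.sqrt (dot u u).

Definition eball (c : E) (r : R) : set E := [set y | enorm (y - c) <= r].

Definition hat (c : E) : E := if c == 0 then 0 else (enorm c)^-1 *: c.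

(* Nearest point of C. On a nonempty closed convex set it exists and is unique;
   the default value 0 is never used there. *)
Definition proj (C : set E) (y : E) : E :=
  xget 0 [set p | C p /\ forall z, C z -> enorm (y - p) <= enorm (y - z)].

(* For convex Omega, the tangent cone at x is the closure of the cone of
   feasible directions. *)
Definition tangent_cone (Omega : set E) (x : E) : set E :=
  closure [set t *: (y - x) | t in [set t : R | 0 <= t] & y in Omega].

Definition pi_ (Omega : set E) (x g : E) : R :=
  enorm (proj (tangent_cone Omega x) g).

Definition grad (f : E -> R^o) (x : E) : E :=
  \row_(i < n) 'D_(delta_mx 0 i) f x.

(* Omega may have empty interior: f is C^1 on some open set containing it. *)
Definition C1_on (Omega : set E) (f : E -> R^o) : Prop :=
  exists U : set E, [/\ open U, Omega `<=` U,
    forall x, U x -> differentiable f x &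
    forall x, U x -> {for x, continuous (grad f)}].

Definition stationary (Omega : set E) (f : E -> R^o) (x : E) : Prop :=
  Omega x /\ pi_ Omega x (- grad f x) = 0.

End euclidean.

Section ssc.
Context {R : realType} {n : nat}.
Local Notation E := 'rV[R]_n.

Definition is_method (Omega : set E) (A : E -> E -> set E) : Prop :=
  forall x g, Omega x ->
  [/\ A x g !=set0,
      A x g `<=` (tangent_cone Omega x `&` [set y | 0 < dot g y]) `|` [set 0],
      pi_ Omega x g = 0 -> A x g = [set 0] &
      pi_ Omega x g <> 0 -> ~ A x g 0].

Definition DSB (Omega : set E) (A : E -> E -> set E) (x g : E) : R :=
  if pi_ Omega x g == 0 then 1
  else inf [set dot g d / (pi_ Omega x g * enorm d) | d in A x g].

Definition SB (Omega : set E) (A : E -> E -> set E) : R :=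
  inf [set DSB Omega A x g | x in Omega & g in [set: E]].

Definition is_max (S : set R) (m : R) : Prop := S m /\ ubound S m.

Definition SSC_region (L : R) (xbar g d : E) : set E :=
  eball (xbar + (2 * L)^-1 *: g) (enorm g / (2 * L))
  `&` eball xbar (dot g (hat d) / L).

Definition is_beta (L : R) (xbar g y d : E) (beta : R) : Prop :=
  (~ SSC_region L xbar g d y -> beta = 0) /\
  (SSC_region L xbar g d y ->
   is_max [set b | 0 <= b /\ SSC_region L xbar g d (y + b *: d)] beta).

(* Standing assumption on the maximal stepsize: positive and feasible, not
   necessarily the largest feasible one. *)
Definition feasible_stepsize (Omega : set E) (y d : E) (amax : R) : Prop :=
  0 < amax /\ forall a, 0 <= a <= amax -> Omega (y + a *: d).

(* SSC_loop Omega A L xbar g y z: some sequence of choices makes the loop, when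
   it is in the state y_j = y, terminate after finitely many steps and
   return z. *)
Inductive SSC_loop (Omega : set E) (A : E -> E -> set E) (L : R) (xbar g : E) :
    E -> E -> Prop :=
| SSC_null y :
    A y g 0 -> SSC_loop Omega A L xbar g y y
| SSC_stop y d amax beta :
    A y g d -> d != 0 -> feasible_stepsize Omega y d amax ->
    is_beta L xbar g y d beta ->
    Num.min amax beta = 0 ->
    SSC_loop Omega A L xbar g y y
| SSC_last y d amax beta :
    A y g d -> d != 0 -> feasible_stepsize Omega y d amax ->
    is_beta L xbar g y d beta ->
    Num.min amax beta != 0 -> Num.min amax beta = beta ->
    SSC_loop Omega A L xbar g y (y + Num.min amax beta *: d)
| SSC_next y d amax beta z :
    A y g d -> d != 0 -> feasible_stepsize Omega y d amax ->
    is_beta L xbar g y d beta ->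
    Num.min amax beta != 0 -> Num.min amax beta != beta ->
    SSC_loop Omega A L xbar g (y + Num.min amax beta *: d) z ->
    SSC_loop Omega A L xbar g y z.

Definition SSC (Omega : set E) (A : E -> E -> set E) (L : R) (xbar g z : E) :
    Prop := SSC_loop Omega A L xbar g xbar z.

(* x and xtr form an infinite run of the first-order method. The trial point
   computed from x k is xtr k.+1; xtr 0 is irrelevant. *)
Definition generated_by_FOM (Omega : set E) (f : E -> R^o)
    (A : E -> E -> set E) (L : R) (x xtr : nat -> E) : Prop :=
  Omega (x 0%N) /\
  forall k : nat,
    [/\ ~ stationary Omega f (x k),
        SSC Omega A L (x k) (- grad f (x k)) (xtr k.+1),
        Omega (x k.+1) &
        f (x k.+1) <= Num.min (f (xtr k.+1))
                        (f (x k) - L / 2 * enorm (x k.+1 - x k) ^+ 2)].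

(* min_(0 <= i <= k) F i; the seed F 0 is itself one of the terms. *)
Definition min_upto (F : nat -> R) (k : nat) : R :=
  \big[Num.min/F 0%N]_(0 <= i < k.+1) F i.

End ssc.

(* Main.v *)
Require Import Defs.
From HB Require Import structures.
From mathcomp Require Import all_boot all_order all_algebra.
From mathcomp Require Import all_classical all_reals all_analysis.
From mathcomp Require Import ring lra.

Set Implicit Arguments.
Unset Strict Implicit.
Unset Printing Implicit Defensive.

Import Order.TTheory GRing.Theory Num.Theory.
Import numFieldNormedType.Exports.

Local Open Scope classical_set_scope.
Local Open Scope ring_scope.

(** Why the theorem holds.  Write [g = - grad f (x k)] and [z = xtr k.+1].

    Sufficient decrease.  Of the two balls of [SSC_region], the one whose radius
    is [|g| / (2 L)] does not depend on the direction; it has [xbar] and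
    [xbar + L^-1 *: g] as antipodal points, so a point [y] lies in it exactly when
    [L * |y - xbar|^2 <= <g, y - xbar>] ([fixed_ballP]).  Every point visited by
    the procedure satisfies this ([SSC_loop_state]): a step never goes past
    [beta], and balls are convex.  For [y = z] the descent lemma
    [f z <= f x - <g, z - x> + L/2 |z - x|^2] then gives
    [f z <= f x - L/2 |z - x|^2], hence [f (x k.+1) <= f (x k) - L/2 |z - x k|^2].
    Since [f] is bounded below on the compact set [Omega], [f (x k)] decreases to
    its infimum [fstar], and [|z - x k|] tends to 0.  Telescoping these
    inequalities gives the rate: the smallest of [k + 1] squares is at most their
    mean ([min_upto_sqr_bound]).

    Criticality of the trial step.  When the procedure stops along a direction
    [d] because the region blocks any further progress, the end point satisfies
    [<g, hat d> <= 2 L |z - xbar|] ([blocked_dist]); the slope bound turns this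
    into [SB * pi_ y g <= 2 L |z - xbar|] for a point [y] of [Omega] which is
    itself within [2 |z - xbar|] of [xbar] ([SSC_loop_slope]).

    Limit points.  The norm of the projection of [g] on the tangent cone at [y]
    bounds the slope of [g] towards every point [w] of [Omega]:
    [<g, w - y> <= pi_ y g * |w - y|] ([dot_le_pi]).  This inequality involves the
    tangent cone, which may jump with [y], only through [pi_], and so passes to the
    limit along iterates approaching a limit point [p]; what remains is
    [<- grad f p, w - p> <= 0] for all [w] in [Omega], that is, stationarity of
    [p] ([limit_point_stationary], [pi_eq0]). *)

(** * Euclidean geometry *)

Section Euclidean.
Context {R : realType} {n : nat}.
Implicit Types (u v w g p : 'rV[R]_n) (a : R).

Lemma dotC u v : dot u v = dot v u.
Proof. by apply: eq_bigr => i _; rewrite mulrC. Qed.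

Lemma dotDl u v w : dot (u + v) w = dot u w + dot v w.
Proof. by rewrite -big_split; apply: eq_bigr => i _; rewrite mxE mulrDl. Qed.

Lemma dotZl a u v : dot (a *: u) v = a * dot u v.
Proof. by rewrite mulr_sumr; apply: eq_bigr => i _; rewrite mxE mulrA. Qed.

Lemma dotNl u v : dot (- u) v = - dot u v.
Proof. by rewrite -scaleN1r dotZl mulN1r. Qed.

Lemma dotDr u v w : dot u (v + w) = dot u v + dot u w.
Proof. by rewrite dotC dotDl !(dotC u). Qed.

Lemma dotZr a u v : dot u (a *: v) = a * dot u v.
Proof. by rewrite dotC dotZl dotC. Qed.

Lemma dotNr u v : dot u (- v) = - dot u v.
Proof. by rewrite dotC dotNl dotC. Qed.

Lemma dot0r u : dot u 0 = 0.
Proof. by apply: big1 => i _; rewrite mxE mulr0. Qed.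

Lemma dot0l u : dot 0 u = 0.
Proof. by rewrite dotC dot0r. Qed.

Definition dotE := (dotDl, dotDr, dotNl, dotNr, dotZl, dotZr).

Lemma dot_ge0 u : 0 <= dot u u.
Proof. by apply: sumr_ge0 => i _; rewrite -expr2 sqr_ge0. Qed.

Lemma enorm_ge0 u : 0 <= enorm u.
Proof. exact: sqrtr_ge0. Qed.

Lemma sqr_enorm u : enorm u ^+ 2 = dot u u.
Proof. by rewrite sqr_sqrtr ?dot_ge0. Qed.

Lemma coord_le_enorm u (i : 'I_n) : `|u 0 i| <= enorm u.
Proof.
rewrite -sqrtr_sqr; apply: ler_wsqrtr.
rewrite /dot (bigD1 i)//= expr2 lerDl.
by apply: sumr_ge0 => j _; rewrite -expr2 sqr_ge0.
Qed.

Lemma enorm_eq0 u : (enorm u == 0) = (u == 0).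
Proof.
apply/eqP/eqP => [u0|->]; last first.
  by rewrite /enorm dot0r sqrtr0.
apply/rowP => i; apply/eqP; rewrite mxE -normr_le0 -u0.
exact: coord_le_enorm.
Qed.

Lemma enorm_gt0 u : (0 < enorm u) = (u != 0).
Proof. by rewrite lt_def enorm_eq0 enorm_ge0 andbT. Qed.

Lemma enorm0 : enorm (0 : 'rV[R]_n) = 0.
Proof. by apply/eqP; rewrite enorm_eq0. Qed.

Lemma enormN u : enorm (- u) = enorm u.
Proof. by rewrite /enorm !dotE opprK. Qed.

Lemma enormZ a u : enorm (a *: u) = `|a| * enorm u.
Proof.
by rewrite /enorm !dotE mulrA -expr2 sqrtrM ?sqr_ge0// sqrtr_sqr.
Qed.

Lemma enormB_sym u v : enorm (u - v) = enorm (v - u).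
Proof. by rewrite -enormN opprB. Qed.

(** Expand [0 <= | |v| u - |u| v |^2]. *)
Lemma cauchy_schwarz u v : dot u v <= enorm u * enorm v.
Proof.
have := dot_ge0 (enorm v *: u - enorm u *: v); rewrite !dotE.
rewrite (dotC v u) -!sqr_enorm.
have := enorm_ge0 u; have := enorm_ge0 v.
rewrite le_eqVlt => /predU1P[/esym/eqP|v0].
  by rewrite enorm_eq0 => /eqP -> _ _; rewrite dot0r /enorm dot0r sqrtr0 mulr0.
rewrite le_eqVlt => /predU1P[/esym/eqP|u0].
  by rewrite enorm_eq0 => /eqP -> _; rewrite dot0l /enorm dot0r sqrtr0 mul0r.
move=> h; have uv0 : 0 < 2 * (enorm u * enorm v) by rewrite !mulr_gt0.
rewrite -subr_ge0 -(pmulr_rge0 _ uv0); apply: le_trans h _.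
by rewrite le_eqVlt; apply/orP; left; apply/eqP; ring.
Qed.

Lemma ler_enormD u v : enorm (u + v) <= enorm u + enorm v.
Proof.
rewrite -ler_sqr ?nnegrE ?addr_ge0 ?enorm_ge0// sqrrD !sqr_enorm !dotE.
by rewrite (dotC v u); have := cauchy_schwarz u v; lra.
Qed.

Lemma dot_hat g d : d != 0 -> dot g (hat d) = dot g d / enorm d.
Proof. by move=> d0; rewrite /hat (negbTE d0) dotZr mulrC. Qed.

(** Boundedness for the Euclidean norm thus implies boundedness for the norm
    that underlies the topology, the one that compactness criteria refer to. *)
Lemma sup_norm_le_enorm u : `|u| <= enorm u.
Proof.
rewrite [leLHS]/Num.Def.normr /= mx_normrE; apply/bigmax_leP; split=> /=.
  exact: enorm_ge0.
by move=> [i j] _ /=; rewrite ord1; exact: coord_le_enorm.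
Qed.

Lemma enorm_continuous : continuous (@enorm R n).
Proof.
move=> u; apply: continuous_comp; last exact: sqrt_continuous.
rewrite /dot; apply: (continuous_big (op := +%R)) => [|i _ {}u].
  exact: add_continuous.
have ui := @coord_continuous R 1 n 0 i u; exact: (cvgM ui ui).
Qed.

Lemma dist_continuous c : continuous (fun u => enorm (u - c)).
Proof.
move=> u; apply: (@continuous_comp _ _ _ (fun u => u - c) (@enorm R n));
  last exact: enorm_continuous.
exact: (cvgB (@cvg_id _ (nbhs u)) (@cvg_cst _ c _ (nbhs u) _)).
Qed.

Lemma enorm_ball_nbhs p e : 0 < e -> nbhs p [set u | enorm (u - p) < e].
Proof.
move=> e0; have /cvgr_lt := @dist_continuous p p.
by apply; rewrite subrr enorm0.
Qed.

End Euclidean.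

(** * Projection on the tangent cone *)

Section ConeProjection.
Context {R : realType} {n : nat}.
Implicit Types (T S Omega : set 'rV[R]_n) (u v w g p : 'rV[R]_n) (a : R).

Lemma closure_sub_closed S T : closed T -> S `<=` T -> closure S `<=` T.
Proof. by move=> /closure_id {2}->; exact: closure_subset. Qed.

Lemma dot_continuous g : continuous (dot g).
Proof.
apply: (continuous_big (op := +%R)) => [|i _ u]; first exact: add_continuous.
exact: (cvgM (@cvg_cst _ (g 0 i) _ (nbhs u) _) (@coord_continuous R 1 n 0 i u)).
Qed.

Lemma closed_sublevel (h : 'rV[R]_n -> R) a :
  continuous h -> closed [set u | h u <= a].
Proof. by move=> ch; exact: ((continuous_closedP h).1 ch _ (@closed_le R a)). Qed.

(** The distance to [g] attains its minimum on the compact part of [T] that is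
    no farther from [g] than some chosen point of [T]. *)
Lemma nearest_point_exists T g : closed T -> T !=set0 ->
  exists p, T p /\ forall z, T z -> enorm (g - p) <= enorm (g - z).
Proof.
move=> Tcl [v0 Tv0].
pose S := T `&` [set z | enorm (z - g) <= enorm (v0 - g)].
have Scl : closed S.
  apply: closedI => //; apply: (@closed_sublevel (fun z => enorm (z - g))).
  exact: dist_continuous.
have Sbd : bounded_set S.
  exists (enorm (v0 - g) + enorm g); split; first exact: num_real.
  move=> M ltM z [_ /= zv0]; apply: (le_trans (sup_norm_le_enorm z)).
  rewrite -(subrK g z) (le_trans (ler_enormD _ _))// ltW//.
  by apply: le_lt_trans ltM; rewrite lerD2r.
have [||p] := @EVT_min_rV R n (fun z => enorm (z - g)) S _
  (bounded_closed_compact Sbd Scl).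
- by exists v0; split => //=.
- by apply: continuous_subspaceT; exact: dist_continuous.
rewrite inE => -[Tp /= pv0] pmin; exists p; split => // z Tz.
rewrite !(enormB_sym g); have [zv0|/ltW vz0] := leP (enorm (z - g)) (enorm (v0 - g)).
  by apply: pmin; rewrite inE.
exact: le_trans vz0.
Qed.

Lemma projP T g : closed T -> T !=set0 ->
  T (Defs.proj T g) /\ forall z, T z -> enorm (g - Defs.proj T g) <= enorm (g - z).
Proof. by move=> Tcl T0; exact: (xgetPex 0 (nearest_point_exists g Tcl T0)). Qed.

(** On the ray spanned by [v], the point nearest to [g] is at squared distance
    [|g|^2 - <g, v>^2 / |v|^2] from [g] when [<g, v> >= 0], while the projection
    [p] is at squared distance [|g|^2 - |p|^2]; the latter is the smaller one. *)
Lemma dot_le_proj_cone T g v : closed T ->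
    (forall t w, 0 <= t -> T w -> T (t *: w)) -> T v ->
  dot g v <= enorm (Defs.proj T g) * enorm v.
Proof.
move=> Tcl Tcone Tv.
have [|Tp pmin] := @projP T g Tcl; first by exists v.
set p := Defs.proj T g in Tp pmin *.
(* [|g - p|^2 <= |g - t w|^2], with [|g|^2] cancelled. *)
have key w t : 0 <= t -> T w ->
    enorm p ^+ 2 - 2 * dot g p <= t ^+ 2 * enorm w ^+ 2 - 2 * t * dot g w.
  move=> t0 Tw; have := pmin _ (Tcone _ _ t0 Tw).
  rewrite -ler_sqr ?nnegrE ?enorm_ge0// !sqr_enorm !dotE.
  by rewrite (dotC p g) (dotC w g); lra.
have [gv|gv] := leP (dot g v) 0.
  by apply: le_trans gv _; rewrite mulr_ge0 ?enorm_ge0.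
have v0 : 0 < enorm v.
  by rewrite enorm_gt0; apply: contraTneq gv => ->; rewrite dot0r ltxx.
(* [p] is also the nearest point on its own ray. *)
have gp : dot g p <= enorm p ^+ 2.
  have [p0|p0] := eqVneq p 0.
    by rewrite p0 dot0r sqr_ge0.
  have {p0}p0 : 0 < enorm p by rewrite enorm_gt0.
  have gp0 : 0 <= dot g p.
    by have := key p 0 (lexx _) Tp; have := sqr_ge0 (enorm p); lra.
  have := key p (dot g p / enorm p ^+ 2) _ Tp.
  rewrite divr_ge0 ?sqr_ge0// => /(_ isT).
  set e := enorm p ^+ 2; have e0 : 0 < e by rewrite exprn_gt0.
  set c := dot g p => h.
  have : (c - e) ^+ 2 <= 0.
    have -> : (c - e) ^+ 2
        = e * (e - 2 * c - ((c / e) ^+ 2 * e - 2 * (c / e) * c)).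
      by field; rewrite gt_eqF.
    by rewrite pmulr_rle0// subr_le0.
  by rewrite real_exprn_even_le0 ?num_real// subr_eq0 => /eqP ->.
have := key v (dot g v / enorm v ^+ 2) _ Tv.
rewrite divr_ge0 ?sqr_ge0 ?(ltW gv)// => /(_ isT) h.
rewrite -ler_sqr ?nnegrE ?(ltW gv) ?mulr_ge0 ?enorm_ge0// exprMn.
rewrite -ler_pdivrMr ?exprn_gt0//.
have -> : dot g v ^+ 2 / enorm v ^+ 2 =
  - ((dot g v / enorm v ^+ 2) ^+ 2 * enorm v ^+ 2
     - 2 * (dot g v / enorm v ^+ 2) * dot g v).
  by field; rewrite gt_eqF.
lra.
Qed.

Lemma proj_eq0 T g : closed T -> T 0 ->
  (forall v, T v -> dot g v <= 0) -> Defs.proj T g = 0.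
Proof.
move=> Tcl T0 gT; have [|Tp /(_ _ T0)] := @projP T g Tcl; first by exists 0.
have := gT _ Tp; set p := Defs.proj T g => gp.
rewrite -ler_sqr ?nnegrE ?enorm_ge0// subr0 !sqr_enorm !dotE (dotC p g) => h.
apply/eqP; rewrite -enorm_eq0 -sqrf_eq0 sqr_enorm eq_le dot_ge0 andbT.
lra.
Qed.

Lemma tangent_cone_closed Omega p : closed (tangent_cone Omega p).
Proof. exact: closed_closure. Qed.

Lemma tangent_cone_dir Omega p w : Omega w -> tangent_cone Omega p (w - p).
Proof.
by move=> Ow; apply: subset_closure; exists 1 => //=; exists w; rewrite ?scale1r.
Qed.

Lemma tangent_cone_scale Omega p t v : 0 <= t ->
  tangent_cone Omega p v -> tangent_cone Omega p (t *: v).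
Proof.
move=> t0; rewrite /tangent_cone; set G := (X in closure X).
apply: (@closure_sub_closed G [set u | closure G (t *: u)]).
  pose sc := @scaler_continuous R 'rV[R]_n t.
  exact: ((continuous_closedP _).1 sc _ (@closed_closure _ _)).
move=> _ [s s0 [y Oy <-]]; apply: subset_closure; rewrite /= scalerA.
by exists (t * s); rewrite /= ?mulr_ge0//; exists y.
Qed.

Lemma dot_le_pi Omega p g w : Omega w ->
  dot g (w - p) <= pi_ Omega p g * enorm (w - p).
Proof.
move=> Ow; apply: dot_le_proj_cone; first exact: tangent_cone_closed.
  by move=> t v; exact: tangent_cone_scale.
exact: tangent_cone_dir.
Qed.

Lemma pi_eq0 Omega p g : Omega p ->
  (forall w, Omega w -> dot g (w - p) <= 0) -> pi_ Omega p g = 0.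
Proof.
move=> Op gO; rewrite /pi_ proj_eq0 ?enorm0//; first exact: closed_closure.
  by rewrite -(subrr p); exact: tangent_cone_dir.
apply: (@closure_sub_closed _ [set v | dot g v <= 0]).
  by apply: closed_sublevel; exact: dot_continuous.
by move=> _ [s s0 [y Oy <-]] /=; rewrite dotZr mulr_ge0_le0 ?gO.
Qed.

End ConeProjection.

(** * The descent lemma *)

Section Descent.
Context {R : realType} {n : nat}.
Implicit Types (f : 'rV[R]_n -> R^o) (Omega : set 'rV[R]_n) (u v w p : 'rV[R]_n).

Lemma derive_dot_grad f p v : differentiable f p -> 'D_v f p = dot (grad f p) v.
Proof.
move=> df; rewrite deriveE// [in LHS](row_sum_delta v) linear_sum /=.
apply: eq_bigr => i _; rewrite linearZ /= -deriveE// /grad mxE.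
by rewrite mulrC.
Qed.

(** The difference quotients of [f] along the line and in the direction [v]
    coincide. *)
Lemma is_derive_line f p v (t : R) : differentiable f (t *: v + p) ->
  is_derive t 1 (fun s : R => f (s *: v + p) : R) (dot (grad f (t *: v + p)) v).
Proof.
move=> df; rewrite -derive_dot_grad//.
have E : (fun h : R => h^-1 *: (((fun s : R => f (s *: v + p)) \o shift t) (h *: 1)
            - f (t *: v + p)))
       = (fun h : R => h^-1 *: ((f \o shift (t *: v + p)) (h *: v) - f (t *: v + p))).
  apply/funext => h /=; congr (_ *: (f _ - _)).
  by rewrite /shift /= scalerDl addrA [_%:A]mulr1.
have dfv : derivable f (t *: v + p) v by exact: diff_derivable.
apply: DeriveDef; first by rewrite /derivable E.
by rewrite /derive E.
Qed.

Lemma convex_segment Omega p w (t : R) : @convex_set R 'rV[R]_n Omega ->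
  Omega p -> Omega w -> 0 <= t <= 1 -> Omega (t *: (w - p) + p).
Proof.
move=> Oc Op Ow /andP[t0 t1].
have := Oc w p (Itv01 t0 t1); rewrite !inE => /(_ Ow Op).
by rewrite /conv/= /unstable.onem scalerBl scale1r scalerBr addrCA addrC.
Qed.

(** The function [psi] below, [f] along the segment minus its claimed upper
    bound, has a nonpositive derivative, because the gradient varies by at most
    [L * t * |v|] between [p] and [t *: v + p]. *)
Lemma descent_lemma Omega f (L : R) p w :
    @convex_set R 'rV[R]_n Omega -> C1_on Omega f ->
    (forall y z, Omega y -> Omega z ->
      enorm (grad f y - grad f z) <= L * enorm (y - z)) ->
    Omega p -> Omega w ->
  f w <= f p + dot (grad f p) (w - p) + L / 2 * enorm (w - p) ^+ 2.
Proof.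
move=> Oc [U [_ OU fdiff _]] gL Op Ow; set v : 'rV[R]_n := w - p.
have seg (t : R) : 0 <= t <= 1 -> Omega (t *: v + p) by exact: convex_segment.
pose a := dot (grad f p) v; pose b := L / 2 * enorm v ^+ 2.
pose psi (t : R) : R := f (t *: v + p) - (t * a + t ^+ 2 * b).
pose dpsi (t : R) : R := dot (grad f (t *: v + p)) v - (a + 2 * t * b).
have psid (t : R) : 0 <= t <= 1 -> is_derive t 1 psi (dpsi t).
  move=> t01; have := is_derive_line (fdiff _ (OU _ (seg t t01))) => df.
  apply: is_derive_eq.
  rewrite /dpsi; congr (_ - _).
  rewrite /GRing.scale /=; ring.
have [c] : exists2 c, c \in `]0, 1[%R & psi 1 - psi 0 = dpsi c * (1 - 0).
  apply: MVT => // [t /[!in_itv]/= /andP[t0 t1]|]; first by apply: psid; lra.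
  apply: derivable_within_continuous => t /[!in_itv]/= t01.
  by have [] := psid t t01.
rewrite in_itv/= => /andP[c0 c1]; rewrite subr0 mulr1.
have : dpsi c <= 0.
  have gc := gL _ _ (seg c _) Op; rewrite /dpsi /a /b.
  have := cauchy_schwarz (grad f (c *: v + p) - grad f p) v.
  have : enorm (grad f (c *: v + p) - grad f p) * enorm v
      <= L * (c * enorm v) * enorm v.
    apply: ler_wpM2r; first exact: enorm_ge0.
    rewrite -[c in leRHS]gtr0_norm// -enormZ.
    by have := gc _; rewrite addrK; apply; lra.
  rewrite dotDl dotNl.
  have -> : 2 * c * (L / 2 * enorm v ^+ 2) = L * (c * enorm v) * enorm v by field.
  lra.
rewrite /psi scale1r scale0r add0r subrK -/a -/b => dc E.
by move: E dc => <-; rewrite expr1n expr0n/=; lra.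
Qed.

End Descent.

(** * The slope bound and the SSC procedure *)

Section SlopeBound.
Context {R : realType} {n : nat}.
Context (Omega : set 'rV[R]_n)
  (A : 'rV[R]_n -> 'rV[R]_n -> set 'rV[R]_n)
  (A_method : is_method Omega A).
Implicit Types (y g d : 'rV[R]_n).

Lemma method_dot_ge0 y g d : Omega y -> A y g d -> 0 <= dot g d.
Proof.
move=> Oy Ad; have [_ Asub _ _] := A_method g Oy.
by case: (Asub _ Ad) => [[_ /= /ltW]//|->]; rewrite dot0r.
Qed.

Lemma pi_ge0 y g : 0 <= pi_ Omega y g.
Proof. exact: enorm_ge0. Qed.

Lemma slope_lbound0 y g : Omega y ->
  lbound [set dot g d / (pi_ Omega y g * enorm d) | d in A y g] 0.
Proof.
move=> Oy _ [d Ad <-].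
by rewrite divr_ge0 ?(method_dot_ge0 Oy)// mulr_ge0 ?pi_ge0 ?enorm_ge0.
Qed.

Lemma DSB_ge0 y g : Omega y -> 0 <= DSB Omega A y g.
Proof.
move=> Oy; rewrite /DSB; case: ifPn => // _; apply: lb_le_inf.
  by have [[d Ad] _ _ _] := A_method g Oy; eexists; exists d.
exact: slope_lbound0.
Qed.

(** An infimum is a lower bound only of a set that is bounded below; here all
    slopes are nonnegative, by the ascent condition on [A]. *)
Lemma SB_slope y g d : Omega y -> A y g d -> d != 0 ->
  SB Omega A * pi_ Omega y g <= dot g (hat d).
Proof.
move=> Oy Ad d0; rewrite dot_hat// ler_pdivlMr ?enorm_gt0//.
have [pi0|pi0] := eqVneq (pi_ Omega y g) 0.
  by rewrite pi0 mulr0 mul0r (method_dot_ge0 Oy).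
have pid : 0 < pi_ Omega y g * enorm d.
  by rewrite mulr_gt0// ?lt_def ?pi0 ?pi_ge0 ?enorm_eq0 ?d0 ?enorm_ge0.
rewrite -mulrA -ler_pdivlMr//; apply: (@le_trans _ _ (DSB Omega A y g)).
  apply: ge_inf; last by exists y => //; exists g.
  by exists 0 => _ [z Oz [h _ <-]]; exact: DSB_ge0.
rewrite /DSB (negbTE pi0); apply: ge_inf; last by exists d.
by exists 0; exact: slope_lbound0.
Qed.

End SlopeBound.

Section SSCProcedure.
Context {R : realType} {n : nat}.
Context (Omega : set 'rV[R]_n) (A : 'rV[R]_n -> 'rV[R]_n -> set 'rV[R]_n).
Context (L : R) (xbar g : 'rV[R]_n).
Context (A_method : is_method Omega A) (L_gt0 : 0 < L).
Implicit Types (y d z u : 'rV[R]_n) (amax beta : R).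

Local Notation fixed_ball := (eball (xbar + (2 * L)^-1 *: g) (enorm g / (2 * L))).

(** Thales: [z] sees the diameter from [xbar] to [xbar + L^-1 *: g] under an
    angle that is at least right. *)
Lemma fixed_ballP z :
  fixed_ball z <-> L * enorm (z - xbar) ^+ 2 <= dot g (z - xbar).
Proof.
have L2 : 0 < 2 * L by rewrite mulr_gt0.
have -> : fixed_ball z
    = is_true (enorm (z - xbar - (2 * L)^-1 *: g) <= (2 * L)^-1 * enorm g).
  by rewrite /eball/= opprD addrA [enorm g / _]mulrC.
rewrite -ler_sqr ?nnegrE ?mulr_ge0 ?invr_ge0 ?enorm_ge0 ?(ltW L2)//.
move: (z - xbar) => u; rewrite exprMn !sqr_enorm !dotE (dotC u g) -(ler_pM2l L2).
rewrite [leLHS](_ : _ = 2 * (L * dot u u - dot g u) + 2 * L * ((2 * L)^-1 ^+ 2 * dot g g)).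
  by rewrite gerDr pmulr_rle0// subr_le0.
by field; rewrite gt_eqF.
Qed.

Lemma eball_segment c r y d (s t : R) : 0 <= s <= t ->
  eball c r y -> eball c r (y + t *: d) -> eball c r (y + s *: d).
Proof.
move=> /andP[s0 st] yr ydr.
have [t0|t0] := eqVneq t 0.
  by have -> : s = 0; [lra | rewrite scale0r addr0].
have {t0 s0 st} [t0 s0 st] : [/\ 0 < t, 0 <= s / t & s / t <= 1].
  have t_gt0 : 0 < t by rewrite lt_def t0 (le_trans s0).
  by rewrite divr_ge0 ?(ltW t_gt0)// ler_pdivrMr// mul1r.
have -> : y + s *: d = y + ((s / t) * t) *: d by rewrite divfK ?gt_eqF.
move: (s / t) s0 st => {}s s0 s1; move: yr ydr; rewrite /eball /=.
have -> : y + (s * t) *: d - c = (1 - s) *: (y - c) + s *: (y + t *: d - c).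
  by apply/rowP => i; rewrite !mxE; ring.
move=> yr ydr; apply: (le_trans (ler_enormD _ _)); rewrite !enormZ.
rewrite !ger0_norm ?subr_ge0//.
have : (1 - s) * enorm (y - c) <= (1 - s) * r by rewrite ler_wpM2l ?subr_ge0.
have : s * enorm (y + t *: d - c) <= s * r by rewrite ler_wpM2l.
lra.
Qed.

(** The invariant of the loop: feasibility and, by [fixed_ballP], membership in
    the ball of [SSC_region] that does not depend on the current direction. *)
Definition SSC_state y :=
  Omega y /\ L * enorm (y - xbar) ^+ 2 <= dot g (y - xbar).

(** A nonzero step presupposes that [y] lies in the region: outside it,
    [beta] is 0 and [amax] is positive. *)
Lemma SSC_step_region y d amax beta :
    feasible_stepsize Omega y d amax -> is_beta L xbar g y d beta ->
    Num.min amax beta != 0 ->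
  SSC_region L xbar g d y /\
  is_max [set b | 0 <= b /\ SSC_region L xbar g d (y + b *: d)] beta.
Proof.
move=> [amax0 _] [out inside] ab.
have [yin|yout] := pselect (SSC_region L xbar g d y).
  by split => //; exact: inside.
by move: ab; rewrite (out yout) min_r ?eqxx ?ltW.
Qed.

Lemma SSC_step_state y d amax beta :
    feasible_stepsize Omega y d amax -> is_beta L xbar g y d beta ->
    Num.min amax beta != 0 ->
  SSC_state (y + Num.min amax beta *: d).
Proof.
move=> fs ib ab; have [[yfix _] [[beta0 [ydfix _]] _]] := SSC_step_region fs ib ab.
case: fs => amax0 feas.
have ab0 : 0 <= Num.min amax beta by rewrite le_min (ltW amax0).
split; first by apply: feas; rewrite ab0 ge_min lexx.
by apply/fixed_ballP; apply: (eball_segment _ yfix ydfix); rewrite ab0 ge_min lexx orbT.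
Qed.

Lemma SSC_loop_state y z :
  SSC_loop Omega A L xbar g y z -> SSC_state y -> SSC_state z.
Proof.
elim=> {y z}// [y d amax beta Ad d0 fs ib ab _ _|y d amax beta z Ad d0 fs ib ab _ _ IH _].
  exact: SSC_step_state fs ib ab.
by apply: IH; exact: SSC_step_state fs ib ab.
Qed.

(** If the end point [z] violated the bound, moving on by a length of
    [<g, hat d> / L - 2 |z - xbar|], which is positive, would stay in both balls,
    against the maximality of [beta]. *)
Lemma blocked_dist y d beta : d != 0 ->
    is_max [set b | 0 <= b /\ SSC_region L xbar g d (y + b *: d)] beta ->
  dot g (hat d) <= 2 * L * enorm (y + beta *: d - xbar).
Proof.
move=> d0 [[beta0 [zfix zctr]] betamax]; rewrite leNgt; apply/negP => zlt.
set z := y + beta *: d in zfix zctr zlt.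
set r := dot g (hat d) / L in zctr.
have D0 : 0 < enorm d by rewrite enorm_gt0.
have N0 := enorm_ge0 (z - xbar).
set N := enorm (z - xbar) in zctr zlt N0.
have rN : 0 < r - 2 * N by rewrite /r subr_gt0 ltr_pdivlMr// mulrAC.
pose s := (r - 2 * N) / enorm d.
have s0 : 0 < s by rewrite divr_gt0.
have sD : s * enorm d = r - 2 * N by rewrite divfK ?gt_eqF.
suff : beta + s <= beta by rewrite gerDl leNgt s0.
apply: betamax; split; first by rewrite addr_ge0 ?(ltW s0).
have zE : y + (beta + s) *: d - xbar = (z - xbar) + s *: d.
  by apply/rowP => i; rewrite /z !mxE; ring.
split; last first.
  rewrite /eball /= zE (le_trans (ler_enormD _ _))// enormZ gtr0_norm// sD.
  by rewrite -/N -/r; lra.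
apply/fixed_ballP; rewrite zE; move/fixed_ballP: zfix; rewrite -/N.
have gd : dot g d = L * r * enorm d.
  by rewrite /r dot_hat//; field; rewrite !gt_eqF.
have := cauchy_schwarz (z - xbar) d; rewrite -/N.
rewrite !sqr_enorm; move: (z - xbar) => u; rewrite !dotE gd (dotC d u).
rewrite -(sqr_enorm d) => ud.
have : L * (s * (2 * dot u d)) <= L * (s * (2 * (N * enorm d))).
  by rewrite !ler_pM2l.
move=> ud2 uu; rewrite [leLHS](_ : _ = L * dot u u + L * (s * (2 * dot u d))
  + L * s * enorm d * (s * enorm d)); last by ring.
rewrite sD.
have -> : L * s * enorm d = L * (r - 2 * N) by rewrite -mulrA sD.
nra.
Qed.

(** The witness [xt] is the point at which the last direction was chosen.  If
    that direction is 0, then [pi_ Omega xt g = 0].  If it is some [d != 0] and the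
    loop stops there, either [beta = 0] and [blocked_dist] applies at [xt] itself,
    or [xt] is outside the region; satisfying the invariant, it is then outside
    the ball centred at [xbar], which gives [<g, hat d> < L |xt - xbar|].  If a last step
    leads from [xt] to [z], then [blocked_dist] applies at [z], and [xt] lies in
    the ball centred at [xbar], of radius [<g, hat d> / L <= 2 |z - xbar|]. *)
Lemma SSC_loop_slope y z : SSC_loop Omega A L xbar g y z -> SSC_state y ->
  exists xt, [/\ Omega xt, enorm (xt - xbar) <= 2 * enorm (z - xbar) &
    SB Omega A * pi_ Omega xt g <= 2 * L * enorm (z - xbar)].
Proof.
elim=> {y z} [y A0|y d amax beta Ad d0 [amax0 _] [_ inside] ab
             |y d amax beta Ad d0 fs ib ab abE
             |y d amax beta z Ad d0 fs ib ab _ _ IH _]; last 1 first.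
- by apply: IH; exact: SSC_step_state fs ib ab.
- move=> [Oy _]; have [_ _ _ nA0] := A_method g Oy.
  have pi0 : pi_ Omega y g = 0 by apply: contrapT => /nA0; exact.
  exists y; have := enorm_ge0 (y - xbar); split => //; first by lra.
  by rewrite pi0 mulr0 !mulr_ge0 ?(ltW L_gt0).
- move=> [Oy yfix]; have yd := SB_slope A_method Oy Ad d0.
  exists y; have N0 := enorm_ge0 (y - xbar); split => //; first by lra.
  apply: (le_trans yd).
  have [yin|yout] := pselect (SSC_region L xbar g d y).
    have bmax := inside yin.
    have b0 : beta = 0.
      by move: ab; case: (leP amax beta) => // _ a0; rewrite a0 ltxx in amax0.
    by have := blocked_dist d0 bmax; rewrite b0 scale0r addr0.
  have : ~ (enorm (y - xbar) <= dot g (hat d) / L).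
    by move=> yctr; apply: yout; split => //; apply/fixed_ballP.
  rewrite ler_pdivlMr// => /negP; rewrite -ltNge => /ltW yL.
  by apply: le_trans yL _; have := mulr_ge0 N0 (ltW L_gt0); lra.
- have [[_ yctr] bmax] := SSC_step_region fs ib ab.
  move=> [Oy _]; exists y; rewrite abE; have zd := blocked_dist d0 bmax.
  split => //; last exact: le_trans (SB_slope A_method Oy Ad d0) zd.
  apply: le_trans yctr _; rewrite ler_pdivrMr//.
  by apply: le_trans zd _; rewrite mulrAC.
Qed.

End SSCProcedure.

(** * Running minima *)

Section MinUpto.
Context {R : realType}.
Implicit Types (F G : nat -> R) (i k : nat).

Lemma min_upto_le F k i : (i <= k)%N -> min_upto F k <= F i.
Proof.
move=> ik; rewrite /min_upto big_mkord.
exact: (@bigmin_le_cond _ _ _ _ (Ordinal (ik : (i < k.+1)%N)) predT (fun j => F (val j))).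
Qed.

Lemma le_min_upto F G k : (forall i, F i <= G i) -> min_upto F k <= min_upto G k.
Proof. by move=> FG; rewrite /min_upto; elim/big_ind2: _ => // *; exact: le_min2. Qed.

(** A positive minimum has a square that is at most the mean of the squares; the
    bound on a nonpositive one is immediate. *)
Lemma min_upto_sqr_bound F (c s : R) k : 0 < c ->
    c * \sum_(i < k.+1) F i ^+ 2 <= s ->
  min_upto F k <= Num.sqrt (s / (c * k.+1%:R)).
Proof.
move=> c0 sumF; have [m0|m0] := leP (min_upto F k) 0.
  exact: le_trans m0 (sqrtr_ge0 _).
have ck : 0 < c * k.+1%:R by rewrite mulr_gt0.
rewrite -[leLHS]gtr0_norm// -sqrtr_sqr ler_wsqrtr// ler_pdivlMr//.
apply: le_trans sumF; rewrite mulrCA ler_pM2l// mulr_natr.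
rewrite -[X in _ *+ X]card_ord -sumr_const; apply: ler_sum => i _.
have mi : min_upto F k <= F i by apply: min_upto_le; rewrite -ltnS.
by rewrite ler_sqr ?nnegrE ?(ltW m0)// (le_trans _ mi) ?ltW.
Qed.

End MinUpto.

(** * Stationarity of limit points *)

Section StationaryLimits.
Context {R : realType} {n : nat}.
Implicit Types (Omega : set 'rV[R]_n) (f : 'rV[R]_n -> R^o)
  (x : nat -> 'rV[R]_n) (p w : 'rV[R]_n).

Lemma cluster_seqP x p (P : nat -> Prop) (e : R) : cluster (x @ \oo) p ->
  (\forall k \near \oo, P k) -> 0 < e -> exists k, P k /\ enorm (x k - p) < e.
Proof.
move=> clp Pk e0; have [|_ [[k Pk' <-] xkp]] :=
  clp [set x k | k in P] _ _ (enorm_ball_nbhs p e0).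
  by apply: filterS Pk => k Pk; exists k.
by exists k.
Qed.

Lemma le0_of_small (a C : R) : 0 <= C ->
  (forall e, 0 < e -> e <= 1 -> a <= e * C) -> a <= 0.
Proof.
move=> C0 aC; rewrite leNgt; apply/negP => a0.
have D0 : 0 < a + C + 1 by lra.
have := aC (a / (a + C + 1)); rewrite divr_gt0// ler_pdivrMr// mul1r.
have le1 : a <= a + C + 1 by lra.
move=> /(_ isT le1); rewrite mulrAC ler_pdivlMr// ler_pM2l//; lra.
Qed.

(** With [gk = - grad f (x k)] and a nearly critical [xt] close to [x k], split
    [<- grad f p, w - p>] as
    [<- grad f p - gk, w - p> + <gk, w - xt> + <gk, xt - p>].  The first term is
    small by Lipschitz continuity of the gradient, the second because
    [pi_ Omega xt gk] is small, the third because [xt] is close to [p].  The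
    criticality is measured with the gradient at [x k], not at [xt], so that
    projections of different vectors need not be compared. *)
Lemma limit_point_stationary Omega f (L c : R) x p :
    closed Omega -> 0 < L -> 0 <= c ->
    (forall y z, Omega y -> Omega z ->
      enorm (grad f y - grad f z) <= L * enorm (y - z)) ->
    (forall k, Omega (x k)) ->
    (forall e : R, 0 < e -> \forall k \near \oo, exists xt,
      [/\ Omega xt, enorm (xt - x k) <= 2 * e &
          pi_ Omega xt (- grad f (x k)) <= c * e]) ->
  cluster (x @ \oo) p -> stationary Omega f p.
Proof.
move=> Ocl L0 c0 gL Ox near_crit clp.
have Op : Omega p.
  apply: Ocl => B Bp.
  have [|q [Oq Bq]] := clp Omega B _ Bp; last by exists q.
  by exists 0%N => // k _; exact: Ox.
split => //; apply: pi_eq0 => // w Ow.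
pose W := enorm (w - p); pose G := enorm (- grad f p).
have [W0 G0] : 0 <= W /\ 0 <= G by rewrite !enorm_ge0.
apply: (@le0_of_small _ (L * W + c * (W + 3) + 3 * (G + L))).
  by rewrite !addr_ge0 ?mulr_ge0 ?addr_ge0 ?(ltW L0).
move=> e e0 e1; have [k [[xt [Oxt xtx pixt]] xkp]] :=
  cluster_seqP clp (near_crit e e0) e0.
set gk := - grad f (x k) in pixt.
have dg : enorm (- grad f p - gk) <= L * e.
  rewrite /gk opprK addrC (le_trans (gL _ _ _ _))//.
  by rewrite ler_wpM2l ?(ltW L0)// ltW.
have xtp : enorm (xt - p) <= 3 * e.
  have -> : xt - p = (xt - x k) + (x k - p) by rewrite addrA subrK.
  by apply: le_trans (ler_enormD _ _) _; lra.
have wxt : enorm (w - xt) <= W + 3 * e.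
  have -> : w - xt = (w - p) + (p - xt) by rewrite addrA subrK.
  by apply: le_trans (ler_enormD _ _) _; rewrite (enormB_sym p) lerD2l.
have gkG : enorm gk <= G + L * e.
  have -> : gk = - grad f p + (gk - (- grad f p)) by rewrite addrC subrK.
  by apply: le_trans (ler_enormD _ _) _; rewrite (enormB_sym gk) lerD2l.
have -> : dot (- grad f p) (w - p)
    = dot (- grad f p - gk) (w - p) + dot gk (w - xt) + dot gk (xt - p).
  by rewrite !dotE; ring.
have T1 : dot (- grad f p - gk) (w - p) <= L * e * W.
  by apply: le_trans (cauchy_schwarz _ _) _; rewrite ler_wpM2r.
have T2 : dot gk (w - xt) <= c * e * (W + 3 * e).
  apply: le_trans (dot_le_pi _ _ Ow) _.
  by rewrite ler_pM ?enorm_ge0.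
have T3 : dot gk (xt - p) <= (G + L * e) * (3 * e).
  by apply: le_trans (cauchy_schwarz _ _) _; rewrite ler_pM ?enorm_ge0.
apply: le_trans (lerD (lerD T1 T2) T3) _.
have ce : c * e * (W + 3 * e) <= c * e * (W + 3).
  by rewrite ler_wpM2l ?mulr_ge0 ?(ltW e0)//; lra.
have Le : (G + L * e) * (3 * e) <= (G + L) * (3 * e).
  by rewrite ler_wpM2r ?lerD2l ?ger_pMr//; lra.
lra.
Qed.

End StationaryLimits.

(** * Convergence of the method *)

Theorem corollary4p1 (R : realType) (n : nat) (Omega : set 'rV[R]_n)
    (f : 'rV[R]_n -> R^o) (L : R) (A : 'rV[R]_n -> 'rV[R]_n -> set 'rV[R]_n)
    (tau K : R) (x xtr : nat -> 'rV[R]_n)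
    (Omega_neq0 : Omega !=set0)
    (Omega_compact : compact Omega)
    (Omega_convex : @convex_set R 'rV[R]_n Omega)
    (f_C1 : C1_on Omega f)
    (L_gt0 : 0 < L)
    (grad_lipschitz : forall y z, Omega y -> Omega z ->
       enorm (grad f y - grad f z) <= L * enorm (y - z))
    (A_method : is_method Omega A)
    (tauE : tau = SB Omega A)
    (tau_gt0 : 0 < tau)
    (KE : K = tau / (L * (1 + tau)))
    (x_run : generated_by_FOM Omega f A L x xtr) :
  (forall k : nat, f (x k.+1) <= f (x k)) /\
  exists fstar : R,
    [/\ (fun k => f (x k)) @ \oo --> (fstar : R^o),
        forall p, cluster (x @ \oo) p -> stationary Omega f p &
        forall xt : nat -> 'rV[R]_n,
          (forall k, Omega (xt k)) ->
          (forall k, K * pi_ Omega (xt k) (- grad f (xt k))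
                     <= enorm (x k - xtr k.+1)) ->
          forall k : nat,
            min_upto (fun i => pi_ Omega (xt i) (- grad f (xt i))) k
              <= min_upto (fun i => enorm (xtr i.+1 - x i) / K) k /\
            min_upto (fun i => enorm (xtr i.+1 - x i) / K) k
              <= Num.sqrt (2 * (f (x 0%N) - fstar) / (K ^+ 2 * L * k.+1%:R))].
Proof.
set z := fun k => xtr k.+1.
have Ox k : Omega (x k).
  by case: k => [|k]; [case: x_run | case: x_run => _ /(_ k)[]].
have Ocl : closed Omega by apply: compact_closed => //; exact: norm_hausdorff.
have zP k : Omega (z k) /\
    L * enorm (z k - x k) ^+ 2 <= dot (- grad f (x k)) (z k - x k).
  have [_ /(_ k)[_ zk _ _]] := x_run.
  apply: (SSC_loop_state L_gt0 zk); split; first exact: Ox.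
  by rewrite subrr enorm0 dot0r expr0n/= mulr0.
have decr k : f (x k.+1) <= f (x k) - L / 2 * enorm (z k - x k) ^+ 2.
  have [_ /(_ k)[_ _ _]] := x_run; rewrite le_min => /andP[fz _].
  apply: le_trans fz _; have [Oz zk] := zP k.
  apply: le_trans (descent_lemma Omega_convex f_C1 grad_lipschitz (Ox k) Oz) _.
  by rewrite dotNl in zk; lra.
have mono k : f (x k.+1) <= f (x k).
  apply: le_trans (decr k) _; rewrite gerBl mulr_ge0 ?sqr_ge0//; lra.
split => //.
have fcont : {within Omega, continuous f}.
  apply: continuous_in_subspaceT => y /[!inE] Oy.
  have [U [_ OU df _]] := f_C1.
  exact: differentiable_continuous (df _ (OU _ Oy)).
have [m _ fm] := EVT_min_rV Omega_neq0 Omega_compact fcont.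
have fx_lb : has_lbound (range (fun k => f (x k) : R)).
  by exists (f m) => _ [k _ <-]; apply: fm; rewrite inE.
pose fstar : R := inf (range (fun k => f (x k) : R)).
have fstar_le k : fstar <= f (x k) by apply: ge_inf => //; exists k.
have fcvg : (fun k => f (x k) : R) @ \oo --> fstar.
  apply: nonincreasing_cvgn => //.
  by apply/nonincreasing_seqP => k; exact: mono.
exists fstar; split => //.
- move=> p; apply: (@limit_point_stationary _ _ _ f L (2 * L / tau)) => //.
    by rewrite divr_ge0 ?mulr_ge0 ?(ltW L_gt0) ?(ltW tau_gt0).
  move=> e e0.
  (* Once [f (x k)] is this close to its limit, the decrease achieved by step [k]
     forces the trial step to be no longer than [e]. *)
  have d0 : 0 < L / 2 * e ^+ 2 by rewrite !mulr_gt0 ?exprn_gt0 ?invr_gt0.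
  have : \forall k \near \oo, f (x k) < fstar + L / 2 * e ^+ 2.
    by apply: cvgr_lt fcvg _ _; rewrite ltrDl.
  apply: filterS => k fk.
  have ze : enorm (z k - x k) <= e.
    rewrite -ler_sqr ?nnegrE ?enorm_ge0 ?(ltW e0)//.
    have L2 : 0 < L / 2 by rewrite divr_gt0.
    rewrite -(ler_pM2l L2); have := decr k; have := fstar_le k.+1; lra.
  have [_ /(_ k)[_ zk _ _]] := x_run.
  have [|xt [Oxt xtx pixt]] := SSC_loop_slope A_method L_gt0 zk.
    split; first exact: Ox.
    by rewrite subrr enorm0 dot0r expr0n/= mulr0.
  exists xt; split => //; first by apply: le_trans xtx _; rewrite ler_pM2l.
  rewrite mulrAC ler_pdivlMr// mulrC tauE; apply: le_trans pixt _.
  by rewrite ler_pM2l ?mulr_gt0.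
- move=> xt Oxt xtK k.
  have K0 : 0 < K by rewrite KE divr_gt0 ?mulr_gt0 ?addr_gt0.
  split.
    by apply: le_min_upto => i; rewrite ler_pdivlMr// mulrC enormB_sym.
  apply: min_upto_sqr_bound; first by rewrite mulr_gt0 ?exprn_gt0.
  have sumD j : L / 2 * \sum_(i < j) enorm (z i - x i) ^+ 2 <= f (x 0%N) - f (x j).
    elim: j => [|j IH]; first by rewrite big_ord0 mulr0 subrr.
    by rewrite big_ord_recr /= mulrDr; have := decr j; lra.
  under eq_bigr do rewrite exprMn exprVn.
  rewrite -mulr_suml; have := sumD k.+1; have := fstar_le k.+1.
  set S := \sum_(i < k.+1) _ => fk Sk.
  have -> : K ^+ 2 * L * (S / K ^+ 2) = L * S by field; rewrite gt_eqF.
  lra.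
Qed.
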